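(* Let $q$ be a power of an odd prime, let $\lambda\in\mathbb{F}_q$ be a non-square, and let $f\in\mathbb{F}_q[X]$ be a permutation polynomial of $\mathbb{F}_q$. Suppose that $\mathcal{G}(\lambda,f)$ is connected, $$\left|\{(f^{-1}(a^2))^2:\ a\in\mathbb{F}_q\}\right|\neq \frac{q-1}{2}\quad\text{and}\quad \left|\{(f^{-1}(\lambda a^2))^2:\ a\in\mathbb{F}_q\}\right|\neq \frac{q-1}{2}.$$ Then $\mathcal{G}(\lambda,f)$ has no Hamiltonian cycle of Type 1.
   Context: For a polynomial $f\in\mathbb{F}_q[X]$ and a non-square $\lambda\in\mathbb{F}_q$, $\mathcal{G}(\lambda,f)$ is the directed graph with vertex set $\mathbb{F}_q$ and an edge from $x$ to $y$ iff $(y^2-f(x))(\lambda y^2-f(x))=0$ (loops allowed). Here $f^{-1}$ denotes the inverse of the bijection $x\mapsto f(x)$ of $\mathbb{F}_q$. Weights: an edge $(x,y)$ has weight $0$ if $y^2=f(x)$ and weight $1$ otherwise (i.e. if $\lambda y^2=f(x)$ but $y^2\ne f(x)$); in particular the edge into vertex $0$ has weight $0$. A trail is a directed path all of whose edges have the same weight; its length is its number of edges. A directed path is of Type $n$ if it contains a trail of length $n$ but no trail of length greater than $n$. A Hamiltonian cycle $H$ of a connected component is of Type $n$ if $H\setminus\{0\}$ (the cycle with vertex $0$ and its incident edges removed) is a path of Type $n$. *)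

(* Defs.v *)
From HB Require Import structures.
From mathcomp Require Import all_boot all_order all_algebra all_field.
Set Implicit Arguments.
Unset Strict Implicit.
Unset Printing Implicit Defensive.
Import Order.TTheory GRing.Theory Num.Theory.
Local Open Scope ring_scope.

Definition nonsquare (F : finFieldType) (lam : F) : Prop :=
  ~ exists b : F, lam = b ^+ 2.

Definition permutation_poly (F : finFieldType) (f : {poly F}) : Prop :=
  bijective (horner f).

Definition edge (F : finFieldType) (lam : F) (f : {poly F}) : rel F :=
  fun x y => (y ^+ 2 - f.[x]) * (lam * y ^+ 2 - f.[x]) == 0.

(* Only meaningful when [edge lam f x y] holds. *)
Definition weight (F : finFieldType) (f : {poly F}) (x y : F) : nat :=
  if y ^+ 2 == f.[x] then 0%N else 1%N.

(* Weak connectedness: paths in the underlying undirected graph. *)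
Definition connected_digraph (T : finType) (e : rel T) : Prop :=
  forall x y : T, connect (fun u v => e u v || e v u) x y.

(* A directed path is given by the nonempty sequence of its distinct vertices. *)
Definition dipath (T : eqType) (e : rel T) (s : seq T) : bool :=
  [&& s != [::], sorted e s & uniq s].

(* The number of edges of a path, not of vertices. *)
Definition path_length (T : Type) (s : seq T) : nat := (size s).-1.

Definition trail (F : finFieldType) (lam : F) (f : {poly F}) (s : seq F)
    : Prop :=
  dipath (edge lam f) s /\
  exists w : nat, sorted (fun x y => weight f x y == w) s.

Definition path_of_type (F : finFieldType) (lam : F) (f : {poly F}) (n : nat)
    (s : seq F) : Prop :=
  [/\ dipath (edge lam f) s,
      exists t, [/\ infix t s, trail lam f t & path_length t = n]
    & forall t, infix t s -> trail lam f t -> (path_length t <= n)%N].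

(* The closing edge, from the last vertex to the first, is part of [cycle]. *)
Definition hamiltonian_cycle (T : finType) (e : rel T) (c : seq T) : Prop :=
  ucycle e c /\ forall x : T, x \in c.

(* For a cycle through x, the vertices other than x in cyclic order from the
   successor of x, i.e. the path left after deleting x and its two edges. *)
Definition cycle_minus (T : eqType) (c : seq T) (x : T) : seq T :=
  behead (rot (index x c) c).

Definition hamiltonian_cycle_of_type (F : finFieldType) (lam : F)
    (f : {poly F}) (n : nat) (c : seq F) : Prop :=
  hamiltonian_cycle (edge lam f) c /\
  path_of_type lam f n (cycle_minus c 0).

(* Main.v *)
(** Delete 0 from a Hamiltonian cycle of Type 1, leaving v_1, ..., v_(q-1).
    Weights alternate along this path, so the edges leaving v_1, v_3, ...,
    v_(q-2) share one weight: f(v_i) = mu v_(i+1)^2 for all odd i, with mu = 1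
    or mu = lam.  As f is injective, the even-indexed vertices have distinct
    squares; there are (q-1)/2 of them, so they contain exactly one of x, -x
    for each x <> 0, and so do the odd-indexed ones.  Hence f^-1 sends the
    nonzero elements mu a^2 onto the odd-indexed vertices, and 0 to
    v_(q-1) <> 0, so the squares of f^-1(mu a^2) are exactly the (q-1)/2
    nonzero squares. *)
Require Import Defs.
From HB Require Import structures.
From mathcomp Require Import all_boot all_order all_algebra all_field.
From mathcomp Require Import zify.
Set Implicit Arguments.
Unset Strict Implicit.
Unset Printing Implicit Defensive.
Import Order.TTheory GRing.Theory Num.Theory.
Local Open Scope ring_scope.

(** Graph-free counting core, to be applied with [O] the vertices v_1, v_3, ..., [h] the successor
    map and [z] the last vertex. Both [O] and its image under [h] pick one element from each pair x,
    -x of nonzero elements, so they have the same squares. *)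
Lemma card_sqr_invF (F : finFieldType) (f : F -> F) (f_inj : injective f)
    (mu z : F) (h : F -> F) (O : {set F}) :
    (2%:R : F) != 0 -> #|F| = #|O|.*2.+1 -> 0 \notin O ->
    {in O, forall x, h x != 0 /\ h x \notin O} ->
    {in O, forall x, f x = mu * h x ^+ 2} ->
    z != 0 -> f z = 0 ->
  #|[set (invF f_inj (mu * a ^+ 2)) ^+ 2 | a : F]| = #|O|.
Proof.
move=> two_neq0 cardF O0 hO fh z0 fz0.
have sqr_h : {in O &, forall x y, h x ^+ 2 = h y ^+ 2 -> x = y}.
  by move=> x y Ox Oy hxy; apply: f_inj; rewrite !fh // hxy.
have h_inj : {in O &, injective h}.
  by move=> x y Ox Oy hxy; apply: sqr_h; rewrite // hxy.
have imh : h @: O = ~: (0 |: O).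
  apply/eqP; rewrite eqEcard card_in_imset //; apply/andP; split.
    apply/subsetP => _ /imsetP [x Ox ->]; have [hx0 hxO] := hO x Ox.
    by rewrite !inE negb_or hx0.
  have := cardsC (0 |: O); rewrite cardsU1 O0 cardF add1n addSn -addnn.
  by move=> [/addnI ->].
(* A value [- h x] outside [O] would be some [h y]; equal squares then force x = y, hence 2 * [h x]
   = 0. *)
have imNh : (fun x => - h x) @: O = O.
  apply/eqP; rewrite eqEcard card_in_imset ?leqnn ?andbT; last first.
    by move=> x y Ox Oy /oppr_inj; apply: h_inj.
  apply/subsetP => _ /imsetP [x Ox ->]; apply: contraT => NhxO.
  have [hx0 _] := hO x Ox.
  have : - h x \in h @: O by rewrite imh !inE negb_or oppr_eq0 hx0.
  case/imsetP => y Oy Nhxy.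
  have xy : x = y by apply: sqr_h; rewrite // -Nhxy sqrrN.
  move: Nhxy; rewrite -xy => /eqP; rewrite eq_sym -addr_eq0 -mulr2n -mulr_natl.
  by rewrite mulf_eq0 (negbTE two_neq0) (negbTE hx0).
have sqr_hP a : a != 0 -> exists2 x, x \in O & a ^+ 2 = h x ^+ 2.
  move=> a0; case: (boolP (a \in O)) => Oa.
    by move: Oa; rewrite -{1}imNh => /imsetP [x Ox ->]; exists x; rewrite ?sqrrN.
  have : a \in h @: O by rewrite imh !inE negb_or a0.
  by case/imsetP => x Ox ->; exists x.
have invE x y : f x = y -> invF f_inj y = x by move=> <-; rewrite invF_f.
have O_neq0 x : x \in O -> x != 0 by apply: contraTneq => ->.
suff -> : [set (invF f_inj (mu * a ^+ 2)) ^+ 2 | a : F]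
          = (fun x => h x ^+ 2) @: O by rewrite card_in_imset.
apply/setP => b; apply/imsetP/imsetP => [[a _ ->] | [x Ox ->]].
  (* For a = 0 the preimage is [z]; being nonzero, it too has a square of the form [h x ^+ 2]. *)
  have [-> | a0] := eqVneq a 0.
    rewrite expr0n mulr0 (invE z) //.
    by have [x Ox zx] := sqr_hP z z0; exists x.
  have [x Ox ->] := sqr_hP a a0; rewrite (invE x) ?fh //.
  by have [y Oy xy] := sqr_hP x (O_neq0 x Ox); exists y.
(* The witness comes from [fh] at [- h x]: the preimage of [mu * h (- h x) ^+ 2] is [- h x], whose
   square is [h x ^+ 2]. *)
have NhxO : - h x \in O by rewrite -imNh; apply: imset_f.
exists (h (- h x)) => //.
by rewrite (invE (- h x)) ?fh // sqrrN.
Qed.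

(** Two consecutive edges of equal weight would form a trail of length 2. *)
Lemma type1_weight_alternates (F : finFieldType) (lam : F) (f : {poly F})
    (s : seq F) (i : nat) :
    path_of_type lam f 1 s -> (i.+2 < size s)%N ->
  weight f s`_i s`_i.+1 != weight f s`_i.+1 s`_i.+2.
Proof.
move=> [/and3P [_ s_sorted s_uniq] _ max1] lti; apply/eqP => eqw.
have sE : s = take i s ++ [:: s`_i; s`_i.+1; s`_i.+2] ++ drop i.+3 s.
  rewrite -{1}(cat_take_drop i s) (drop_nth 0 (ltnW (ltnW lti))).
  by rewrite (drop_nth 0 (ltnW lti)) (drop_nth 0 lti).
have t_infix : infix [:: s`_i; s`_i.+1; s`_i.+2] s by apply/infixP; eauto.
suff /(max1 _ t_infix) : trail lam f [:: s`_i; s`_i.+1; s`_i.+2] by [].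
split; last by exists (weight f s`_i s`_i.+1); rewrite /= eqw !eqxx.
apply/and3P; split=> //; last exact: subseq_uniq (infixW t_infix) s_uniq.
by move: s_sorted; rewrite {1}sE => /cat_sorted2 [_ /cat_sorted2 []].
Qed.

Lemma edge_weightE (F : finFieldType) (lam : F) (f : {poly F}) (x y : F) :
  edge lam f x y ->
  f.[x] = (if weight f x y == 0%N then 1 else lam) * y ^+ 2.
Proof.
rewrite /edge /weight mulf_eq0 !subr_eq0.
by case: eqP => [-> _ | _ /= /eqP ->] //=; rewrite mul1r.
Qed.

Lemma hamiltonian_cycle_minus (T : finType) (e : rel T) (c : seq T) (x : T) :
    hamiltonian_cycle e c ->
  [/\ cycle e (x :: cycle_minus c x), uniq (x :: cycle_minus c x)
    & #|T| = (size (cycle_minus c x)).+1].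
Proof.
move=> [/andP [c_cycle c_uniq] c_all].
have rotE : rot (index x c) c = x :: cycle_minus c x.
  by rewrite /cycle_minus /rot (drop_nth x) ?index_mem // nth_index.
split; first by rewrite -rotE rot_cycle.
  by rewrite -rotE rot_uniq.
have -> : (size (cycle_minus c x)).+1 = size c.
  by rewrite -(size_rot (index x c) c) rotE.
by rewrite -(card_uniqP c_uniq); apply: eq_card => y; rewrite c_all.
Qed.

Lemma type1_card_sqr_invF (F : finFieldType) (lam : F) (f : {poly F})
    (f_inj : injective (horner f)) (c : seq F) :
    odd #|F| -> (2%:R : F) != 0 -> hamiltonian_cycle_of_type lam f 1 c ->
  exists2 mu, mu = 1 \/ mu = lam &
    #|[set (invF f_inj (mu * a ^+ 2)) ^+ 2 | a : F]| = ((#|F| - 1) %/ 2)%N.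
Proof.
move=> oddF two_neq0 [/(@hamiltonian_cycle_minus _ _ _ 0) []].
set s := cycle_minus c 0 => /= s_cycle /andP [s0 s_uniq] cardFs s_type.
have {cardFs} cardF : #|F| = (size s).+1 := cardFs.
have [m sz_s] : exists m, size s = m.*2.
  by exists (size s)./2; move: oddF; rewrite cardF; lia.
have m_gt0 : (0 < m)%N.
  case: s_type => /and3P []; rewrite -size_eq0 sz_s double_eq0 => + _ _ _ _.
  by rewrite lt0n.
(* For the last i, the default value 0 of [nth] is the deleted vertex, so the edge back into 0 is
   covered as well. *)
have s_edge i : (i < size s)%N -> edge lam f s`_i s`_i.+1.
  move=> lti; have /= := pathP 0 s_cycle i.+1.
  rewrite size_rcons ltnS => /(_ lti); rewrite /= !nth_rcons lti.
  case: ltngtP => [//|lt2|->]; first by rewrite ltnS leqNgt lti in lt2.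
  by rewrite [s`_(size s)]nth_default.
(* Weights are 0 or 1, so two alternations restore the weight. *)
have w_even j : (j < m)%N ->
    weight f s`_j.*2 s`_j.*2.+1 = weight f s`_0 s`_1.
  elim: j => // j IHj ltj; rewrite -IHj; last by lia.
  have := @type1_weight_alternates _ _ _ _ j.*2 s_type.
  have := @type1_weight_alternates _ _ _ _ j.*2.+1 s_type.
  rewrite !sz_s doubleS => /(_ ltac:(lia)) w1 /(_ ltac:(lia)).
  by move: w1; rewrite /weight; do 3!case: ifP => _.
pose mu : F := if weight f s`_0 s`_1 == 0%N then 1 else lam.
exists mu; first by rewrite /mu; case: ifP; [left | right].
(* Positions count from 0, so v_1, v_3, ... sit at the even positions. *)
pose O : {set F} := [set s`_(nat_of_ord j).*2 | j : 'I_m].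
pose h (x : F) := s`_(index x s).+1.
have index_s i : (i < m.*2)%N -> index s`_i s = i.
  by move=> lti; rewrite index_uniq // sz_s.
have s_neq0 i : (i < m.*2)%N -> s`_i != 0.
  by move=> lti; apply: contraNneq s0 => <-; rewrite mem_nth // sz_s.
have ltO (j : 'I_m) : (j.*2.+1 < m.*2)%N by have := ltn_ord j; lia.
have cardO : #|O| = m.
  rewrite card_imset ?card_ord // => i j /(congr1 (index^~ s)).
  rewrite !index_s ?(ltnW (ltO _)) // => /double_inj; exact: val_inj.
rewrite (@card_sqr_invF _ _ _ mu s`_(m.*2.-1) h O) ?cardO //.
- by rewrite cardF sz_s; lia.
- by rewrite cardF sz_s.
- by apply/imsetP => -[j _ /esym/eqP]; apply/negP/s_neq0/ltnW.
- move=> _ /imsetP [j _ ->]; rewrite /h index_s ?(ltnW (ltO _)) //.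
  split; first exact: s_neq0.
  apply/imsetP => -[i _ /(congr1 (index^~ s))].
  by rewrite !index_s ?(ltnW (ltO _)) //; lia.
- move=> _ /imsetP [j _ ->]; rewrite /h index_s ?(ltnW (ltO _)) //.
  by rewrite /mu -(w_even j) //; apply: edge_weightE; rewrite s_edge // sz_s ltnW.
- by apply: s_neq0; lia.
(* The edge from the last vertex enters 0, so [f] vanishes there whatever the weight. *)
- have ltm : (m.*2.-1 < size s)%N by rewrite sz_s; lia.
  rewrite (edge_weightE (s_edge _ ltm)) [s`_(m.*2.-1).+1]nth_default.
    by rewrite expr0n mulr0.
  by rewrite sz_s; lia.
Qed.

Theorem theorem2p8 (p k : nat) (F : finFieldType) (p_prime : prime p)
    (p_odd : odd p) (cardF : #|F| = (p ^ k)%N)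
    (lam : F) (lam_nonsquare : nonsquare lam)
    (f : {poly F}) (f_perm : permutation_poly f)
    (G_connected : connected_digraph (edge lam f))
    (card_sq : #|[set (invF (bij_inj f_perm) (a ^+ 2)) ^+ 2 | a : F]|
               <> ((#|F| - 1) %/ 2)%N)
    (card_lam_sq :
       #|[set (invF (bij_inj f_perm) (lam * a ^+ 2)) ^+ 2 | a : F]|
       <> ((#|F| - 1) %/ 2)%N) :
  ~ exists c : seq F, hamiltonian_cycle_of_type lam f 1 c.
Proof.
case=> c c_type.
have pcharF : p \in [pchar F] by apply: (card_finPcharP cardF).
have two_neq0 : (2%:R : F) != 0.
  rewrite -(dvdn_pcharf pcharF) dvdn_prime2 //.
  by apply: contraTneq p_odd => ->.
have oddF : odd #|F| by rewrite cardF oddX p_odd orbT.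
have [mu [] ->] := type1_card_sqr_invF (bij_inj f_perm) oddF two_neq0 c_type.
  by under eq_imset => a do rewrite mul1r.
by [].
Qed.
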